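(* Let $(X,\mathsf d)$ be a complete and separable metric space and let $\gamma\colon\mathrm{Dom}(\gamma)\to X$ be a Lipschitz curve, where $\mathrm{Dom}(\gamma)\subset\mathbb R$ is non-empty and compact. Then $\gamma$ is metric differentiable at $\mathcal L^1$-a.e. point of $\mathrm{Dom}(\gamma)$.
   Context: Write $\gamma_t:=\gamma(t)$ and $\mathcal L^1$ for Lebesgue measure on $\mathbb R$. Borel sets $E_i\subset\mathbb R$ shrink nicely to $t$ if there are $r_i>0$ and $\alpha>0$ with $E_i\subset B_{r_i}(t)$ and $\mathcal L^1(E_i)\ge\alpha\,\mathcal L^1(B_{r_i}(t))$ for all $i$. A curve $\gamma$ is metric differentiable at $t\in\mathrm{Dom}(\gamma)$ if the limit of $\mathsf d(\gamma_{t+s},\gamma_{t+\tau})/|s-\tau|$ exists along all sequences $s,\tau\to0$ with $t+s,t+\tau\in\mathrm{Dom}(\gamma)$ such that the intervals with endpoints $t+s$ and $t+\tau$ shrink nicely to $t$; the common limit is denoted $|d\gamma|(t)$. *)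

(* Defs.v *)
From HB Require Import structures.
From mathcomp Require Import all_boot all_order all_algebra.
From mathcomp Require Import all_classical all_reals all_analysis.

Set Implicit Arguments.
Unset Strict Implicit.
Unset Printing Implicit Defensive.

Import Order.TTheory GRing.Theory Num.Theory.
Import numFieldNormedType.Exports.

Local Open Scope classical_set_scope.
Local Open Scope ring_scope.

#[short(type="completeMetricType")]
HB.structure Definition CompleteMetric (R : numDomainType) :=
  {T of Complete T & Metric R T}.

Definition separable (T : topologicalType) : Prop :=
  exists2 S : set T, countable S & dense S.

(* The library's [k.-lipschitz_A f] needs normed modules on both sides. *)
Definition lipschitz_curve (R : realType) (X : metricType R)
    (D : set R) (g : R -> X) : Prop :=
  exists L : R, forall s t, D s -> D t -> mdist (g s) (g t) <= L * `|s - t|.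

(* Unlike the library's [nicely_shrinking], this does not require the radii to
   tend to 0; in [is_metric_derivative] that follows from s, u --> 0. *)
Definition shrink_nicely (R : realType) (t : R) (E : (set R)^nat) : Prop :=
  (forall n, measurable (E n)) /\
  exists (r : R^nat) (alpha : R),
    [/\ forall n, 0 < r n,
        0 < alpha,
        forall n, E n `<=` ball t (r n) &
        forall n, (alpha%:E * lebesgue_measure (ball t (r n)) <=
                   lebesgue_measure (E n))%E].

(* A curve with domain D is a total function g of which only the values on D
   matter. Nice shrinking forces s n != u n, so the quotient is never 0 / 0. *)
Definition is_metric_derivative (R : realType) (X : metricType R)
    (D : set R) (g : R -> X) (t l : R) : Prop :=
  forall s u : R^nat,
    s n @[n --> \oo] --> (0 : R) ->
    u n @[n --> \oo] --> (0 : R) ->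
    (forall n, D (t + s n)) ->
    (forall n, D (t + u n)) ->
    shrink_nicely t (fun n =>
      `[Num.min (t + s n) (t + u n), Num.max (t + s n) (t + u n)]%classic) ->
    mdist (g (t + s n)) (g (t + u n)) / `|s n - u n| @[n --> \oo] --> l.

(* An isolated point of D has no admissible sequences, and g is then
   (vacuously) metric differentiable there. *)
Definition metric_differentiable (R : realType) (X : metricType R)
    (D : set R) (g : R -> X) (t : R) : Prop :=
  D t /\ exists l : R, is_metric_derivative D g t l.

(* Main.v *)
(* Let (x_k) be dense in X and let F_k be a Lipschitz extension to R of
   t |-> d(g t, x_k), so that d(g a, g b) = sup_k |F_k a - F_k b| for a, b in
   the domain. By Radon-Nikodym, F_k has a bounded density h_k. Put
   m := sup_k |h_k|. Then d(g a, g b) <= int_[a, b] m, and Lebesgue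
   differentiation at t bounds the upper limit of the difference quotients by
   m t. Conversely each quotient dominates that of F_k, whose limit is |h_k t|,
   so the lower limit is at least sup_k |h_k t| = m t. *)
Require Import Defs.
From HB Require Import structures.
From mathcomp Require Import all_boot all_order all_algebra.
From mathcomp Require Import all_classical all_reals all_analysis.
From mathcomp Require Import measurable_realfun ring lra.

Set Implicit Arguments.
Unset Strict Implicit.
Unset Printing Implicit Defensive.

Import Order.TTheory GRing.Theory Num.Theory.
Import numFieldNormedType.Exports.

Local Open Scope classical_set_scope.
Local Open Scope ring_scope.

(** * Stieltjes measures of Lipschitz functions *)

Lemma lebesgue_stieltjes_measure_oc (R : realType) (f : cumulative R R)
    (a b : R) :
  a <= b -> lebesgue_stieltjes_measure f `]a, b]%classic = (f b - f a)%:E.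
Proof.
move=> ab; rewrite /lebesgue_stieltjes_measure /measure_extension.
by rewrite measurable_mu_extE/=; [rewrite wlength_itv_bnd|exact: is_ocitv].
Qed.

Lemma lipschitz_right_continuous (R : realType) (C : R) (G : R -> R) :
  (forall x y, `|G x - G y| <= C * `|x - y|) -> right_continuous G.
Proof.
move=> GC; apply: right_continuousW => x; apply/cvgrPdist_le => e e0.
have C0 : 0 <= C.
  by have := le_trans (normr_ge0 _) (GC 1 0); rewrite subr0 normr1 mulr1.
(* [C] may be 0, so the modulus of continuity is taken as [e / (C + 1)]. *)
have C1 : 0 < C + 1 by rewrite ltr_wpDl.
near=> y; rewrite (le_trans (GC x y))//.
rewrite (@le_trans _ _ ((C + 1) * `|x - y|))// ?ler_wpM2r// ?lerDl//.
rewrite mulrC -ler_pdivlMr//; near: y.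
by apply: cvgr_dist_le; [exact: cvg_id|rewrite divr_gt0].
Unshelve. all: by end_near. Qed.

(* The complementary function C x - G x is monotone as well, and the two
   Stieltjes measures add up to C times the Lebesgue measure. *)
Lemma lebesgue_stieltjes_measure_lipschitz (R : realType) (C : R)
    (G : cumulative R R) (A : set R) :
  (forall x y, `|G x - G y| <= C * `|x - y|) -> measurable A ->
  (lebesgue_stieltjes_measure G A <= C%:E * lebesgue_measure A)%E.
Proof.
move=> GC mA.
have C0 : 0 <= C.
  by have := le_trans (normr_ge0 _) (GC 1 0); rewrite subr0 normr1 mulr1.
pose H x := C * x - G x; pose K (x : R) := C * x.
have nK : nondecreasing K by move=> x y xy; rewrite /K ler_wpM2l.
have nH : nondecreasing H.
  move=> x y xy; have := GC y x.
  rewrite (ger0_norm (x := y - x)) ?subr_ge0// => h.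
  have := le_trans (ler_norm _) h; rewrite /H; lra.
have cK : right_continuous K.
  apply: (@lipschitz_right_continuous _ C) => x y.
  by rewrite /K -mulrBr normrM (ger0_norm C0).
have cH : right_continuous H.
  apply: (@lipschitz_right_continuous _ (C + C)) => x y.
  rewrite /H (_ : _ - _ = C * (x - y) - (G x - G y)); last by ring.
  by rewrite (le_trans (ler_normB _ _))// mulrDl lerD// normrM (ger0_norm C0).
pose Hc : cumulative R R := HB.pack H (isCumulative.Build R _ R H nH cH).
pose Kc : cumulative R R := HB.pack K (isCumulative.Build R _ R K nK cK).
pose nu : {measure set (measurableTypeR R) -> \bar R} :=
  measure_add (lebesgue_stieltjes_measure G) (lebesgue_stieltjes_measure Hc).
have nuE X : (nu X = lebesgue_stieltjes_measure G X
                   + lebesgue_stieltjes_measure Hc X)%E by exact: measure_addE.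
pose la : {measure set (measurableTypeR R) -> \bar R} :=
  mscale (NngNum C0) lebesgue_measure.
(* By uniqueness it suffices to compare on half-open intervals, where [K = G + H] gives the
   equality; [KL] rests on the same principle. *)
have KG : lebesgue_stieltjes_measure Kc A = nu A.
  apply: lebesgue_stieltjes_measure_unique => // X /ocitvP[->|[[a b] /= ab ->]].
    by rewrite !measure0.
  rewrite nuE !lebesgue_stieltjes_measure_oc ?(ltW ab)//=.
  by rewrite -EFinD /K /H; congr EFin; ring.
have KL : lebesgue_stieltjes_measure Kc A = la A.
  apply: lebesgue_stieltjes_measure_unique => // X /ocitvP[->|[[a b] /= ab ->]].
    by rewrite !measure0.
  rewrite /la /mscale/= lebesgue_stieltjes_measure_oc ?(ltW ab)//=.
  by rewrite lebesgue_measure_itv/= lte_fin ab -EFinD -EFinM mulrBr.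
have -> : (C%:E * lebesgue_measure A = la A)%E by [].
by rewrite -KL KG nuE leeDl.
Qed.

(** * Locally integrable densities of Lipschitz functions *)

Lemma locally_integrable_cst (R : realType) (c : R) :
  locally_integrable setT (cst c).
Proof.
split; [exact: measurable_cst|exact: openT|move=> K _ cK].
have -> : (\int[lebesgue_measure]_(x in K) `|(cst c x)%:E|
    = `|c|%:E * lebesgue_measure K)%E.
  by rewrite -integral_cst//; exact: compact_measurable.
by rewrite lte_mul_pinfty//; exact: compact_finite_measure.
Qed.

Lemma locally_integrable_itv (R : realType) (h : R -> R) (a b : R) :
  locally_integrable setT h ->
  lebesgue_measure.-integrable `[a, b] (EFin \o h).
Proof.
move=> [mh _ ih]; apply/integrableP; split.
  by apply/measurable_EFinP; exact: measurable_funS mh.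
by apply: ih => //; exact: segment_compact.
Qed.

(** Adding [C * x] makes [F] nondecreasing, and the resulting Stieltjes measure is dominated by
    Lebesgue measure. The Radon-Nikodym density of the sum, minus [C], is then a density of [F].
    Restricting to []-N, N]] makes the measure finite. *)
Lemma lipschitz_density (R : realType) (C : R) (F : R -> R) (N : R) :
  (forall x y, `|F x - F y| <= C * `|x - y|) ->
  exists2 h : R -> R, locally_integrable setT h &
    forall a b, - N <= a -> a <= b -> b <= N ->
      (\int[lebesgue_measure]_(x in `[a, b]) (h x)%:E = (F b - F a)%:E)%E.
Proof.
move=> FC.
have C0 : 0 <= C.
  by have := le_trans (normr_ge0 _) (FC 1 0); rewrite subr0 normr1 mulr1.
pose G x := F x + C * x.
have nG : nondecreasing G.
  move=> x y xy; have := FC y x.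
  rewrite (ger0_norm (x := y - x)) ?subr_ge0// ler_norml /G; lra.
have GC x y : `|G x - G y| <= (C + C) * `|x - y|.
  rewrite /G (_ : _ - _ = (F x - F y) + C * (x - y)); last by ring.
  by rewrite (le_trans (ler_normD _ _))// mulrDl lerD// normrM (ger0_norm C0).
have cG := lipschitz_right_continuous GC.
pose Gc : cumulative R R := HB.pack G (isCumulative.Build R _ R G nG cG).
pose D : set (measurableTypeR R) := `]- N, N]%classic.
have mD : measurable D by exact: measurable_itv.
(* If [N < - N], no [a <= b] lies between the bounds and any density will do. *)
have [N0|N0] := ltP N (- N).
  exists (cst 0); first exact: locally_integrable_cst.
  move=> a b Na ab bN.
  by have := le_trans (le_trans Na ab) bN; rewrite leNgt N0.
have nuD : (lebesgue_stieltjes_measure Gc D < +oo)%E.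
  by rewrite lebesgue_stieltjes_measure_oc// ltry.
pose nu : {finite_measure set (measurableTypeR R) -> \bar R} := mfrestr mD nuD.
have nula : nu `<< lebesgue_measure.
  apply/null_content_dominatesP => A mA A0.
  apply/eqP; rewrite eq_le measure_ge0 andbT.
  apply: le_trans (_ : lebesgue_stieltjes_measure Gc A <= _)%E.
    by apply: le_measure; rewrite ?inE//; exact: measurableI.
  rewrite (le_trans (@lebesgue_stieltjes_measure_lipschitz _ _ Gc _ GC mA))//.
  by rewrite A0 mule0.
have [f [f0 ffin intf fE]] := radon_nikodym_sigma_finite nula.
pose h0 x := fine (f x).
have h0E : EFin \o h0 = f by apply/funext => x /=; rewrite /h0 fineK.
have lh0 : locally_integrable setT h0.
  by apply: open_integrable_locally => //; [exact: openT|rewrite h0E].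
exists (h0 \- cst C).
  by apply: locally_integrableB => //; exact: locally_integrable_cst.
move=> a b Na ab bN.
have mh : measurable_fun setT (h0 \- cst C).
  by apply: measurable_funB => //; case: lh0.
under eq_integral do rewrite /= EFinB.
rewrite integralB//; last 2 first.
- exact: locally_integrable_itv.
- by apply: locally_integrable_itv; exact: locally_integrable_cst.
rewrite integral_cst// [X in (_ - _ * X)%E]lebesgue_measure_itv/= lte_fin.
(* The left endpoint is dropped, at no cost to the integral, to reach the half-open intervals whose
   Stieltjes measure is known. *)
rewrite -integral_itv_obnd_cbnd; last first.
  by apply/measurable_EFinP; case: lh0 => + _ _; exact: measurable_funS.
have -> : (\int[lebesgue_measure]_(x in `]a, b]) (h0 x)%:E = (G b - G a)%:E)%E.
  rewrite (_ : (fun x => _) = f)// -fE// /nu/= /mfrestr /mrestr setIidl.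
    exact: lebesgue_stieltjes_measure_oc.
  by apply: subset_itv; rewrite bnd_simp.
move: ab; rewrite le_eqVlt => /predU1P[->|ab].
  by rewrite ltxx mule0 sube0 !subrr.
by rewrite ab; apply: (congr1 EFin); rewrite /G; ring.
Qed.

(** * Differentiation of integrals along nicely shrinking intervals *)

(** The radius [|p n| + |q n| + (q n - p n)] tends to 0 and is at most [C + 1] times the length of
    the interval; its last summand puts the endpoints strictly inside the open ball. *)
Lemma nicely_shrinking_itv (R : realType) (p q : R^nat) (C x : R) :
  p n @[n --> \oo] --> (0 : R) -> q n @[n --> \oo] --> (0 : R) ->
  (forall n, p n < q n) ->
  (forall n, `|p n| + `|q n| <= C * (q n - p n)) ->
  nicely_shrinking x (fun n => `[x + p n, x + q n]%classic).
Proof.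
move=> p0 q0 pq Cpq; split; first by move=> n; exact: measurable_itv.
have C0 : 0 <= C.
  rewrite -(@pmulr_rge0 _ (q 0%N - p 0%N)) ?subr_gt0// mulrC.
  by rewrite (le_trans _ (Cpq 0%N))// addr_ge0.
have r0 n : 0 < `|p n| + `|q n| + (q n - p n).
  by rewrite ltr_wpDl ?addr_ge0// subr_gt0.
exists (2 * (C + 1), fun n => PosNum (r0 n)); split => /=.
- by rewrite mulr_gt0// ltr_wpDl.
- rewrite [X in _ --> X](_ : _ = `|0 : R| + `|0 : R| + (0 - 0)); last first.
    by rewrite normr0 subrr !addr0.
  apply: cvgD; last exact: cvgB.
  by apply: cvgD; exact: cvg_norm.
- move=> n y /=; rewrite in_itv/= /ball/= => /andP[py yq].
  have := ler_norm (- p n); have := ler_norm (q n); rewrite normrN.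
  by move: (pq n) (normr_ge0 (p n)) (normr_ge0 (q n)); rewrite ltr_norml; lra.
- move=> n; rewrite lebesgue_measure_ball ?(ltW (r0 n))//.
  rewrite lebesgue_measure_itv/= lte_fin ltrD2l pq -EFinB -EFinM lee_fin.
  by have := Cpq n; rewrite mulr2n; lra.
Qed.

Lemma lebesgue_pt_itv (R : realType) (h : R -> R) (p q : R^nat) (C t : R) :
  p n @[n --> \oo] --> (0 : R) -> q n @[n --> \oo] --> (0 : R) ->
  (forall n, p n < q n) ->
  (forall n, `|p n| + `|q n| <= C * (q n - p n)) ->
  locally_integrable setT h -> lebesgue_pt h t ->
  (\int[lebesgue_measure]_(x in `[(t + p n), (t + q n)]) h x) / (q n - p n)
    @[n --> \oo] --> h t.
Proof.
move=> p0 q0 pq Cpq lh ht.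
have := nice_lebesgue_differentiation
  (fun x => nicely_shrinking_itv x p0 q0 pq Cpq) lh ht.
move=> /fine_cvg; apply: cvg_trans; apply: near_eq_cvg; near=> n => /=.
rewrite lebesgue_measure_itv/= lte_fin ltrD2l pq -EFinB.
(* The inverse of an extended real is a real inverse only away from 0, which [p n < q n]
   guarantees. *)
rewrite inver ifF; last by apply/negbTE; rewrite subr_eq0 gt_eqF// ltrD2l.
have hfin := @integrable_fin_num _ (measurableTypeR R) _ _ _
  (measurable_itv _) _ (locally_integrable_itv (t + p n) (t + q n) lh).
by rewrite fineM// mulrC; congr (_ / _) => /=; ring.
Unshelve. all: by end_near. Qed.

(** * Extension of Lipschitz functions and a pointwise bound on their densities *)

(* McShane's extension. *)
Lemma lipschitz_extension (R : realType) (D : set R) (C : R) (f : R -> R) :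
  0 <= C -> D !=set0 ->
  (forall x y, D x -> D y -> `|f x - f y| <= C * `|x - y|) ->
  exists2 F : R -> R, (forall x y, `|F x - F y| <= C * `|x - y|) &
    (forall x, D x -> F x = f x).
Proof.
move=> C0 [z Dz] fC; pose V x := [set f y + C * `|x - y| | y in D].
have V0 x : V x !=set0 by exists (f z + C * `|x - z|), z.
(* Any point [y] of [D] shows that the infimum is finite; the choice [y = x] later gives [f x] as a
   lower bound when [x] is in [D]. *)
have lbV x y : D y -> lbound (V x) (f y - C * `|x - y|).
  move=> Dy _ [w Dw <-]; have := le_trans (ler_norm _) (fC _ _ Dy Dw).
  have : C * `|y - w| <= C * (`|x - y| + `|x - w|).
    by rewrite ler_wpM2l// (distrC x y) (le_trans (ler_distD x y w)).
  by rewrite mulrDr; lra.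
have hV x : has_lbound (V x) by exists (f z - C * `|x - z|); exact: lbV.
have half x y : inf (V x) - inf (V y) <= C * `|x - y|.
  rewrite lerBlDr -lerBlDl; apply: lb_le_inf => // _ [w Dw <-].
  rewrite lerBlDl (@le_trans _ _ (f w + C * `|x - w|))//.
    by apply: ge_inf => //; exists w.
  have : C * `|x - w| <= C * (`|x - y| + `|y - w|).
    by rewrite ler_wpM2l// ler_distD.
  by rewrite mulrDr; lra.
exists (fun x => inf (V x)) => [x y|x Dx].
  by rewrite ler_norml half andbT lerNl opprB distrC half.
apply/eqP; rewrite eq_le; apply/andP; split.
  by apply: ge_inf => //; exists x => //; rewrite subrr normr0 mulr0 addr0.
by apply: lb_le_inf => //; have := lbV x x Dx; rewrite subrr normr0 mulr0 subr0.
Qed.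

(** At a Lebesgue point, [h t] is the limit of the difference quotients of [F] over intervals
    centred at [t], each bounded by [C]. *)
Lemma lipschitz_density_le (R : realType) (C N : R) (F h : R -> R) (t : R) :
  (forall x y, `|F x - F y| <= C * `|x - y|) ->
  locally_integrable setT h ->
  (forall a b, - N <= a -> a <= b -> b <= N ->
    \int[lebesgue_measure]_(x in `[a, b]) h x = F b - F a) ->
  lebesgue_pt h t -> - N < t < N -> `|h t| <= C.
Proof.
move=> FC lh hF ht /andP[Nt tN].
(* [c] is the distance from [t] to the ends of [[-N, N]], so every interval [[t - q n, t + q n]]
   stays where [h] is a density of [F]. *)
pose c := Num.min (t + N) (N - t).
have c0 : 0 < c by rewrite lt_min; apply/andP; split; lra.
pose q n : R := c * n.+1%:R^-1; pose p n := - q n.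
have q0 n : 0 < q n by rewrite mulr_gt0// invr_gt0.
have cq : q n @[n --> \oo] --> (0 : R).
  by rewrite -(mulr0 c); apply: cvgMr; exact: cvg_harmonic.
have cp : p n @[n --> \oo] --> (0 : R) by rewrite -oppr0; exact: cvgN.
have pq n : p n < q n by rewrite /p gtrN.
have Cpq n : `|p n| + `|q n| <= 1 * (q n - p n).
  by rewrite mul1r /p opprK normrN !ger0_norm ?(ltW (q0 n)).
have /cvg_norm hn := lebesgue_pt_itv cp cq pq Cpq lh ht.
apply: (cvgr_to_le hn).
apply: nearW => n /=.
have qc : q n <= c by rewrite ler_piMr ?(ltW c0)// invf_le1// ler1n.
have [cN1 cN2] : c <= t + N /\ c <= N - t.
  by split; rewrite /c ge_min lexx ?orbT.
rewrite hF; [|rewrite /p; lra|rewrite lerD2l ltW//|lra].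
rewrite normrM normfV ler_pdivrMr ?normr_gt0 ?subr_eq0 ?gt_eqF//.
by rewrite (le_trans (FC _ _))// (_ : t + q n - _ = q n - p n)//; ring.
Qed.

(** * The supremum of countably many densities *)

Lemma locally_integrable_bounded (R : realType) (f : R -> R) (C : R) :
  measurable_fun setT f -> (forall x, `|f x| <= C) -> locally_integrable setT f.
Proof.
move=> mf fC; split => //; first exact: openT.
move=> K _ cK; have mK := compact_measurable cK.
apply: (@le_lt_trans _ _ (\int[lebesgue_measure]_(x in K) (cst C%:E x))%E).
  apply: ge0_le_integral => //.
  - apply/measurable_EFinP; apply: measurableT_comp => //.
    exact: measurable_funS mf.
  - by move=> x _; rewrite lee_fin.
rewrite integral_cst//.
rewrite lte_mul_pinfty ?lee_fin ?(le_trans _ (fC 0))//.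
exact: compact_finite_measure.
Qed.

(** The number [d n] stands for the distance between two points of the curve; the last two
    hypotheses say that it is the supremum over [k] of the increments of [F k]. The null set is
    fixed before the sequences, so it serves all of them at once. *)
Lemma sup_density_cvg (R : realType) (C N : R) (F : nat -> R -> R) :
  (forall k x y, `|F k x - F k y| <= C * `|x - y|) ->
  exists m : R -> R, {ae (@lebesgue_measure R), forall t, - N < t < N ->
    forall (p q d : R^nat) (K : R),
      p n @[n --> \oo] --> (0 : R) -> q n @[n --> \oo] --> (0 : R) ->
      (forall n, p n < q n) ->
      (forall n, `|p n| + `|q n| <= K * (q n - p n)) ->
      (forall n, - N < t + p n) -> (forall n, t + q n < N) ->
      (forall n k, `|F k (t + q n) - F k (t + p n)| <= d n) ->
      (forall n e, 0 < e ->
        exists k, d n <= `|F k (t + q n) - F k (t + p n)| + e) ->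
      d n / (q n - p n) @[n --> \oo] --> m t}.
Proof.
move=> FC.
have C0 : 0 <= C.
  by have := le_trans (normr_ge0 _) (FC 0%N 1 0); rewrite subr0 normr1 mulr1.
have /choice[h hP] k : exists h : R -> R, locally_integrable setT h /\
    forall a b, - N <= a -> a <= b -> b <= N ->
      \int[lebesgue_measure]_(x in `[a, b]) h x = F k b - F k a.
  have [h lh hF] := lipschitz_density N (FC k).
  by exists h; split => // a b Na ab bN; rewrite /Rintegral hF.
(* Almost everywhere |h k t| <= C on ]-N, N[; the truncation makes the supremum
   locally integrable without discarding points. *)
pose u t k := Num.min `|h k t| C.
pose m t := sups (u t) 0.
have ubu t : has_ubound (range (u t)).
  by exists C => _ [k _ <-]; rewrite /u ge_min lexx orbT.
have mE t : m t = sup (range (u t)).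
  by rewrite /m /sups; congr sup; apply/seteqP; split => y [k _ <-]; exists k.
have um t k : u t k <= m t by rewrite mE; apply: ub_le_sup => //; exists k.
have u0 t k : 0 <= u t k by rewrite le_min normr_ge0.
have m0 t : 0 <= m t by exact: le_trans (um t 0%N).
have mC t : m t <= C.
  rewrite mE; apply: ge_sup; first by exists (u t 0%N), 0%N.
  by move=> _ [k _ <-]; rewrite /u ge_min lexx orbT.
have mm : measurable_fun setT m.
  apply: measurable_fun_sups => [t _|k]; first exact: ubu.
  apply: (@measurable_minr _ _ _ _ (fun t => `|h k t|) (cst C)) => //.
  by apply: measurableT_comp => //; case: (hP k) => -[].
have lm : locally_integrable setT m.
  by apply: (@locally_integrable_bounded _ _ C) => // x; rewrite ger0_norm.
have hpt : {ae (@lebesgue_measure R), forall t k, lebesgue_pt (h k) t}.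
  by apply: ae_foralln => k; apply: lebesgue_differentiation; case: (hP k).
have mpt := lebesgue_differentiation lm.
(* The truncation at [C] is harmless here: [|h k t| <= C] at almost every [t] of [[a, b]], hence
   [|h k| <= m] almost everywhere. The strict inequalities keep the closed interval inside []-N,
   N[], where that bound holds. *)
have Fm k a b : - N < a -> a <= b -> b < N ->
    `|F k b - F k a| <= \int[lebesgue_measure]_(x in `[a, b]) m x.
  move=> Na ab bN; have [lh hF] := hP k; have [mh _ _] := lh.
  rewrite -hF ?(ltW Na) ?(ltW bN)//.
  have ih := locally_integrable_itv a b lh.
  have im := locally_integrable_itv a b lm.
  rewrite (le_trans (le_normr_Rintegral _ ih))//.
  have inh : lebesgue_measure.-integrable `[a, b] (EFin \o (fun x => `|h k x|)).
    exact: integrable_norm.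
  apply: fine_le; [exact: integrable_fin_num|exact: integrable_fin_num|].
  apply: ae_ge0_le_integral => //.
  - exact: measurable_int inh.
  - by move=> x _; rewrite lee_fin.
  - exact: measurable_int im.
  apply: (@filterS _ _ (ae_filter_ringOfSetsType lebesgue_measure)) hpt.
  move=> t /(_ k) ht; rewrite /= in_itv/= => /andP[ta tb].
  rewrite lee_fin (le_trans _ (um t k))// le_min lexx/=.
  apply: (lipschitz_density_le (FC k) lh hF ht).
  by rewrite (lt_le_trans Na)// (le_lt_trans tb).
exists m; apply: (@filterS2 _ _ (ae_filter_ringOfSetsType lebesgue_measure))
  hpt mpt => t ht mt tN p q d K p0 q0 pq Kpq Np qN Fd dF.
have qp0 n : 0 < q n - p n by rewrite subr_gt0.
have ab n : t + p n <= t + q n by rewrite lerD2l ltW.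
have hm := lebesgue_pt_itv p0 q0 pq Kpq lm mt.
(* The bound [Fm] does not depend on [k], so it passes to the supremum [d n]. *)
have dm n : d n <= \int[lebesgue_measure]_(x in `[(t + p n), (t + q n)]) m x.
  apply/ler_addgt0Pr => e /(dF n)[k /le_trans]; apply.
  by rewrite lerD2r Fm.
apply/cvgrPdist_le => e e0.
(* The index [k] depends on [t] and [e] but not on [n]. Half of [e] is spent on approaching the
   supremum, the other half on the convergence of the quotients of [F k]. *)
have [_ [k _ <-] mk] : exists2 y, range (u t) y & m t - e / 2 < y.
  rewrite mE; apply: sup_adherent; first by rewrite divr_gt0.
  by split => //; exists (u t 0%N), 0%N.
have {}mk : m t - e / 2 < `|h k t| by rewrite (lt_le_trans mk)// ge_min lexx.
have [lh hF] := hP k.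
have /cvg_norm hk := lebesgue_pt_itv p0 q0 pq Kpq lh (ht k).
near=> n; rewrite ler_distlC; apply/andP; split.
  have : `|h k t| - e / 2 <= `|F k (t + q n) - F k (t + p n)| / (q n - p n).
    rewrite -hF ?(ltW (Np n)) ?(ltW (qN n))// -(gtr0_norm (qp0 n)).
    rewrite -normf_div.
    by near: n; apply: (cvgr_ge _ hk); rewrite gtrBl divr_gt0.
  have : `|F k (t + q n) - F k (t + p n)| / (q n - p n) <= d n / (q n - p n).
    by rewrite ler_pM2r ?invr_gt0.
  by move: mk; lra.
apply: (@le_trans _ _ ((\int[lebesgue_measure]_(x in `[(t + p n), (t + q n)])
    m x) / (q n - p n))).
  by rewrite ler_pM2r ?invr_gt0.
by near: n; apply: (cvgr_le _ hm); rewrite ltrDl.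
Unshelve. all: by end_near. Qed.

(** * Distance functions to a dense sequence and the passage to metric derivatives *)

Lemma mdist_lipschitz (R : realType) (X : metricType R) (x y z : X) :
  `|mdist x z - mdist y z| <= mdist x y.
Proof.
have := metric_triangle x y z; have := metric_triangle y x z.
by rewrite (metric_sym y x) ler_norml; lra.
Qed.

(** The point [x0] makes the dense countable set nonempty, hence the range of a sequence. *)
Lemma separable_dense_seq (R : realType) (X : metricType R) (x0 : X) :
  separable X -> exists x : nat -> X,
    forall y (e : R), 0 < e -> exists k, mdist y (x k) < e.
Proof.
move=> [S cS dS].
have S0 : S !=set0.
  by have [|y [_ Sy]] := dS setT _ openT; [exists x0|exists y].
have [S_eq0|[x]] := elimT pfcard_geP cS.
  by move: S0; rewrite S_eq0 => -[].
exists x => y e e0.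
have [oB By] := open_nbhs_ball y (PosNum e0).
have [|z [/interior_subset + Sz]] := dS _ _ oB; first by exists y.
rewrite ballEmdist/= => yz.
by have [k _ kz] := 'surj_x Sz; exists k; rewrite kz.
Qed.

Theorem proposition3p8 (R : realType) (X : completeMetricType R)
    (D : set R) (g : R -> X) :
  separable X ->
  D !=set0 ->
  compact D ->
  lipschitz_curve D g ->
  {ae (@lebesgue_measure R), forall t, D t -> metric_differentiable D g t}.
Proof.
move=> sX D0 cD [L gL].
have [x xd] := separable_dense_seq (g 0) sX.
(* The constant is [|L|] because [L] may be negative, while the extension asks for a nonnegative
   one. *)
have /choice[F FP] k : exists F : R -> R,
    (forall s t, `|F s - F t| <= `|L| * `|s - t|) /\
    (forall s, D s -> F s = mdist (g s) (x k)).
  have gk s t : D s -> D t ->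
      `|mdist (g s) (x k) - mdist (g t) (x k)| <= `|L| * `|s - t|.
    move=> Ds Dt; rewrite (le_trans (mdist_lipschitz _ _ _))//.
    by rewrite (le_trans (gL _ _ Ds Dt))// ler_wpM2r// ler_norm.
  have [f f1 f2] := lipschitz_extension (normr_ge0 L) D0 gk.
  by exists f.
have FC k := (FP k).1; have FE k := (FP k).2.
have [M DM] : exists M, forall s, D s -> - M < s < M.
  have [M [_ MD]] := compact_bounded cD.
  (* Boundedness gives [|s| <= |M| + 1]; the extra 1 makes the inclusion in []-M, M[] strict for the
     new bound. *)
  exists (`|M| + 2) => s Ds; rewrite -ltr_norml.
  have := MD (`|M| + 1) _ s Ds; rewrite /= => /(_ _)/le_lt_trans -> //.
    by rewrite (le_lt_trans (ler_norm _))// ltrDl.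
  by rewrite ltrD2l ltr1n.
have [m mP] := sup_density_cvg M FC.
apply: (@filterS _ _ (ae_filter_ringOfSetsType lebesgue_measure)) mP => t mt Dt.
split => //; exists (m t) => s u s0 u0 Ds Du [_ [r [al [r0 al0 Er alE]]]].
pose p n := Num.min (s n) (u n); pose q n := Num.max (s n) (u n).
have tp n : Num.min (t + s n) (t + u n) = t + p n by rewrite addr_minr.
have tq n : Num.max (t + s n) (t + u n) = t + q n by rewrite addr_maxr.
have qpE n : q n - p n = `|s n - u n|.
  rewrite /q /p; case: ltP => su; last by rewrite ger0_norm ?subr_ge0.
  by rewrite ltr0_norm ?subr_lt0// opprB.
have Dp n : D (t + p n) by rewrite /p; case: ltP.
have Dq n : D (t + q n) by rewrite /q; case: ltP.
(* Were [p n = q n], the interval would be null, against the positive lower bound on its measure. *)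
have pq n : p n < q n.
  have := alE n; rewrite tp tq lebesgue_measure_ball ?(ltW (r0 n))//.
  rewrite lebesgue_measure_itv/= lte_fin ltrD2l; case: ltP => // _.
  by rewrite -EFinM lee_fin leNgt mulr_gt0// pmulrn_lgt0.
(* Together with [|p n| < r n] and [|q n| < r n], this turns nice shrinking into
   [|p n| + |q n| <= al^-1 * (q n - p n)]. *)
have rE n : r n *+ 2 <= al^-1 * (q n - p n).
  have := alE n; rewrite tp tq lebesgue_measure_ball ?(ltW (r0 n))//.
  rewrite lebesgue_measure_itv/= lte_fin ltrD2l pq -EFinM -EFinB lee_fin.
  rewrite ler_pdivlMl//; lra.
have pr n : `|p n| < r n.
  have : ball t (r n) (t + p n).
    by apply: Er; rewrite /= tp tq in_itv/= lexx lerD2l ltW.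
  by rewrite /ball/= opprD addNKr normrN.
have qr n : `|q n| < r n.
  have : ball t (r n) (t + q n).
    by apply: Er; rewrite /= tp tq in_itv/= lexx lerD2l ltW.
  by rewrite /ball/= opprD addNKr normrN.
have sel0 (w : R^nat) : (forall n, w n = s n \/ w n = u n) ->
    w n @[n --> \oo] --> (0 : R).
  move=> wE; apply/cvgr0Pnorm_le => e e0; near=> n.
  have [->|->] := wE n; near: n; last by move/cvgr0Pnorm_le: u0; exact.
  by move/cvgr0Pnorm_le: s0; exact.
under eq_fun do rewrite -qpE.
have -> : (fun n => mdist (g (t + s n)) (g (t + u n)) / (q n - p n)) =
    (fun n => mdist (g (t + q n)) (g (t + p n)) / (q n - p n)).
  by apply/funext => n; rewrite /q /p; case: ltP => _ //; rewrite metric_sym.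
apply: (mt (DM _ Dt) p q (fun n => mdist (g (t + q n)) (g (t + p n))) al^-1)
  => //.
- by apply: sel0 => n; rewrite /p; case: ltP; [left|right].
- by apply: sel0 => n; rewrite /q; case: ltP; [right|left].
- by move=> n; rewrite (le_trans _ (rE n))// mulr2n lerD// ltW.
- by move=> n; case/andP: (DM _ (Dp n)).
- by move=> n; case/andP: (DM _ (Dq n)).
- by move=> n k; rewrite !FE//; exact: mdist_lipschitz.
- move=> n e e0; have e2 : 0 < e / 2 by rewrite divr_gt0.
  (* With [x k] within [e / 2] of [g (t + p n)], the triangle inequality through [x k] exceeds the
     difference of the two distances to [x k] by twice [mdist (g (t + p n)) (x k)], which is less
     than [e]. *)
  have [k hk] := xd (g (t + p n)) _ e2.
  exists k; rewrite !FE//.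
  have := metric_triangle (g (t + q n)) (x k) (g (t + p n)).
  have := ler_norm (mdist (g (t + q n)) (x k) - mdist (g (t + p n)) (x k)).
  by rewrite (metric_sym (x k)); lra.
Unshelve. all: by end_near. Qed.
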